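(* Let $a, b, \mu, \nu$ be positive real numbers, and suppose that (i) $\dfrac{\Gamma(a+2\mu)}{\Gamma(a+3\mu)}<\dfrac{3\Gamma(b+3\nu)}{8\Gamma(b+2\nu)}$; (ii) $\dfrac{\Gamma(a+\mu)\Gamma(a+3\mu)}{\Gamma^2(a+2\mu)}<\dfrac{16\Gamma^2(b+2\nu)}{9\Gamma(b+\nu)\Gamma(b+3\nu)}$; and also that $$\frac{2\Gamma(a)\Gamma(b)}{\Gamma(a+\mu)\Gamma(b+\nu)}-\frac{3(1-e)\Gamma(a)\Gamma(b)}{\Gamma(a+2\mu)\Gamma(b+2\nu)}<\frac{2}{\sqrt{5}}.$$ Then the function $\mathbb{W}_{(\mu,a),(\nu,b)}(z)$ is starlike in $\mathbb{D}$.
   Context: $\mathbb{D}=\{z\in\mathbb{C}:|z|<1\}$. The normalized four parameters Wright function is $$\mathbb{W}_{(\mu,a),(\nu,b)}(z)=\sum_{k=0}^{\infty}\frac{\Gamma(a)\Gamma(b)}{\Gamma(a+k\mu)\Gamma(b+k\nu)}\,z^{k+1}.$$ An analytic function $f$ on $\mathbb{D}$ with $f(0)=0$, $f'(0)=1$ is called starlike in $\mathbb{D}$ if $f$ is univalent in $\mathbb{D}$ and $f(\mathbb{D})$ is a star-shaped domain with respect to $0$; equivalently, $\Re\left(zf'(z)/f(z)\right)>0$ for all $z\in\mathbb{D}$. *)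

(* Defs.v *)
(* Stdlib classical reals with Coquelicot. *)
From Stdlib Require Import Reals.
From Coquelicot Require Import Coquelicot.

Open Scope R_scope.

(* Euler's integral over ]0, +oo[, improper at both ends.  [Rpower t (x - 1)]
   is [exp ((x - 1) * ln t)], the usual power for [0 < t].  Only meaningful
   for [0 < x], where the integral converges. *)
Definition Gamma (x : R) : R :=
  RInt_gen (fun t : R => Rpower t (x - 1) * exp (- t))
    (at_right 0) (Rbar_locally p_infty).

Definition wright_coeff (mu a nu b : R) (k : nat) : R :=
  Gamma a * Gamma b / (Gamma (a + INR k * mu) * Gamma (b + INR k * nu)).

(* [iota P] is the element satisfying [P] when it is unique: here, the sum of
   the series of complex numbers. *)
Definition Wright (mu a nu b : R) (z : C) : C :=
  iota (T := C_CompleteNormedModule)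
    (is_series (K := C_AbsRing) (V := C_NormedModule)
      (fun k : nat => (RtoC (wright_coeff mu a nu b k) * Cpow z (k + 1))%C)).

Definition unit_disk (z : C) : Prop := Cmod z < 1.

Definition analytic_on (D : C -> Prop) (f : C -> C) : Prop :=
  forall z : C, D z -> ex_derive (K := C_AbsRing) (V := C_NormedModule) f z.

Definition injective_on (D : C -> Prop) (f : C -> C) : Prop :=
  forall z w : C, D z -> D w -> f z = f w -> z = w.

Definition image (D : C -> Prop) (f : C -> C) (w : C) : Prop :=
  exists z : C, D z /\ f z = w.

(* Connectedness, the other half of being a domain, follows from the
   segments to 0. *)
Definition star_domain_0 (S : C -> Prop) : Prop :=
  open S /\ S (RtoC 0) /\
  forall (w : C) (t : R), S w -> 0 <= t <= 1 -> S (RtoC t * w)%C.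

Definition starlike_in_disk (f : C -> C) : Prop :=
  analytic_on unit_disk f /\
  f (RtoC 0) = RtoC 0 /\
  is_derive (K := C_AbsRing) (V := C_NormedModule) f (RtoC 0) (RtoC 1) /\
  injective_on unit_disk f /\
  star_domain_0 (image unit_disk f).

(* Main.v *)
(* Write the Wright function as [f z = z + sum A_k z^(k+1)].  Log-convexity of
   Gamma makes [A_(k+1) / A_k] nonincreasing, and with [r = A_2 / A_1 <= A_1]
   the last hypothesis forces [r < 7/25] and [2 A_1 < 1 - 3 r / 2].  Since
   [(k + 1) A_k <= 2 A_1 (3 r / 2)^(k-1)], the sum of the [(k + 1) A_k] over
   [k >= 1] is less than [1], which is a classical sufficient condition for
   starlikeness: [f] is then a Lipschitz perturbation of the identity, hence
   injective and open, and [|f - z f'| <= |f|].  The latter makes the modulus of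
   the preimage of [t w] decrease as [t] does, so segments to 0 can be lifted. *)

Require Import Defs.
From Stdlib Require Import Reals.
From Coquelicot Require Import Coquelicot.
From Stdlib Require Import Lra Lia.
Open Scope R_scope.

(** * Gamma *)

Lemma exp_monotone (x y : R) : x <= y -> exp x <= exp y.
Proof. intros [h | ->]; [left; apply exp_increasing, h | right; reflexivity]. Qed.

Definition gamma_integrand (x t : R) : R := Rpower t (x - 1) * exp (- t).

Lemma gamma_integrand_pos (x t : R) : 0 < gamma_integrand x t.
Proof. apply Rmult_lt_0_compat; apply exp_pos. Qed.

Lemma gamma_integrand_continuous (x t : R) :
  0 < t -> continuous (gamma_integrand x) t.
Proof.
  intros ht.
  apply (ex_derive_continuous (gamma_integrand x)).
  unfold gamma_integrand, Rpower. auto_derive. exact ht.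
Qed.

Lemma gamma_integrand_ex_RInt (x u v : R) :
  0 < u -> 0 < v -> ex_RInt (gamma_integrand x) u v.
Proof.
  intros hu hv. apply (ex_RInt_continuous (V := R_CompleteNormedModule)).
  intros z [hz _]. apply gamma_integrand_continuous.
  revert hz. unfold Rmin. destruct (Rle_dec u v); lra.
Qed.

(** This is [ln s <= s - 1] at [s = t / (2 * x)], with the leftover [- x] dropped. Half of the
    exponential decay survives, which keeps the right-hand side integrable at infinity. *)
Lemma power_exp_bound (x t : R) : 0 < x -> 0 < t ->
  exp (x * ln t) * exp (- t) <= exp (x * ln (2 * x)) * exp (- (t / 2)).
Proof.
  intros hx ht. rewrite <- !exp_plus.
  assert (hl : ln (t / (2 * x)) <= t / (2 * x) - 1).
  { assert (hp : 0 < t / (2 * x)) by (apply Rdiv_lt_0_compat; lra).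
    pose proof (exp_ineq1_le (ln (t / (2 * x)))) as h.
    rewrite exp_ln in h by exact hp. lra. }
  rewrite ln_div in hl by lra.
  assert (hm : x * (ln t - ln (2 * x)) <= x * (t / (2 * x) - 1))
    by (apply Rmult_le_compat_l; lra).
  replace (x * (t / (2 * x) - 1)) with (t / 2 - x) in hm by (field; lra).
  apply exp_monotone. lra.
Qed.

(** Uniformity in [u] and [v] is the point: it makes the set of proper integrals bounded above, so
    that a supremum exists even when the integrand blows up at [0]. *)
Lemma gamma_integral_bound (x u v : R) : 0 < x -> 0 < u -> u <= v ->
  RInt (gamma_integrand x) u v <= 3 * exp (x * ln (2 * x)) / x.
Proof.
  intros hx hu huv.
  set (K := exp (x * ln (2 * x))).
  assert (hK : 0 < K) by apply exp_pos.
  (* [t^(x-1) e^(-t) <= Phi'(t)] because [x t^(x-1) e^(-t)] differs from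
     the derivative of [t^x e^(-t)] by [t^x e^(-t) <= K e^(-t/2)]. *)
  set (Phi := fun t : R =>
    (exp (x * ln t) * exp (- t) - 2 * K * exp (- (t / 2))) / x).
  set (phi := fun t : R =>
    exp (x * ln t) / t * exp (- t)
    + (K * exp (- (t / 2)) - exp (x * ln t) * exp (- t)) / x).
  assert (hPhi : is_RInt phi u v (Phi v - Phi u)).
  { apply (is_RInt_derive (V := R_CompleteNormedModule) Phi phi);
      intros t ht; rewrite Rmin_left in ht by exact huv.
    - unfold Phi, phi. auto_derive. lra. unfold Rdiv; field. lra.
    - apply (ex_derive_continuous phi). unfold phi. auto_derive.
      repeat split; lra. }
  apply Rle_trans with (Phi v - Phi u).
  - rewrite <- (is_RInt_unique _ _ _ _ hPhi).
    apply RInt_le; [exact huv | apply gamma_integrand_ex_RInt; lra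
      | eexists; exact hPhi | ].
    intros t ht. unfold gamma_integrand, phi, Rpower.
    replace ((x - 1) * ln t) with (x * ln t - ln t) by ring.
    unfold Rminus at 1. rewrite exp_plus, exp_Ropp, exp_ln by lra.
    pose proof (power_exp_bound x t hx ltac:(lra)) as hb. fold K in hb.
    assert (0 <= (K * exp (- (t / 2)) - exp (x * ln t) * exp (- t)) / x)
      by (apply Rdiv_le_0_compat; lra).
    unfold Rdiv in *. lra.
  - unfold Phi.
    (* One [K] bounds the boundary term [v^x e^(-v)], the other two come from
       [2 * K * exp (- (u / 2))]; the remaining terms of [Phi v - Phi u] are negative. *)
    replace (3 * K / x) with ((K + 2 * K) / x) by (unfold Rdiv; ring).
    unfold Rdiv. rewrite <- Rmult_minus_distr_r.
    apply Rmult_le_compat_r; [left; apply Rinv_0_lt_compat; exact hx | ].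
    pose proof (power_exp_bound x v hx ltac:(lra)) as hbv. fold K in hbv.
    assert (he : forall s, 0 < s -> exp (- (s / 2)) <= 1).
    { intros s hs. rewrite <- exp_0. apply exp_monotone. lra. }
    pose proof (he v ltac:(lra)). pose proof (he u hu).
    pose proof (exp_pos (- (v / 2))). pose proof (exp_pos (- (u / 2))).
    assert (0 < exp (x * ln u) * exp (- u))
      by (apply Rmult_lt_0_compat; apply exp_pos).
    nra.
Qed.

Lemma RInt_nonneg_incr (f : R -> R) (u' u v v' : R) :
  (forall t, 0 < t -> 0 <= f t) ->
  (forall s t, 0 < s -> 0 < t -> ex_RInt f s t) ->
  0 < u' -> u' <= u -> u <= v -> v <= v' -> RInt f u v <= RInt f u' v'.
Proof.
  intros hf hi hu' hu huv hv.
  rewrite <- (RInt_Chasles f u' u v') by (apply hi; lra).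
  rewrite <- (RInt_Chasles f u v v') by (apply hi; lra).
  assert (0 <= RInt f u' u)
    by (apply RInt_ge_0; [lra | apply hi; lra | intros; apply hf; lra]).
  assert (0 <= RInt f v v')
    by (apply RInt_ge_0; [lra | apply hi; lra | intros; apply hf; lra]).
  unfold plus; simpl. lra.
Qed.

(** The integral of a nonnegative function grows with the interval: once some [[u, v]] comes within
    [eps] of the supremum, every larger interval does too. *)
Lemma is_RInt_gen_nonneg_lub (f : R -> R) (S : R) :
  (forall t, 0 < t -> 0 <= f t) ->
  (forall s t, 0 < s -> 0 < t -> ex_RInt f s t) ->
  is_lub (fun y => exists u v, 0 < u /\ u <= v /\ y = RInt f u v) S ->
  is_RInt_gen f (at_right 0) (Rbar_locally p_infty) S.
Proof.
  intros hf hi [hub hlub] P [eps hP].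
  assert (hex : exists u v, 0 < u /\ u <= v /\ S - eps < RInt f u v).
  { apply Classical_Prop.NNPP. intros hn.
    assert (S <= S - eps); [ | pose proof (cond_pos eps); lra].
    apply hlub. intros y (u & v & hu & huv & ->).
    apply Rnot_lt_le. intros hlt. apply hn. exists u, v. auto. }
  destruct hex as (u & v & hu & huv & huv').
  unfold filtermapi. exists (fun s => 0 < s < u) (fun t => v < t).
  - exists (mkposreal u hu). intros s hs hs0.
    unfold ball in hs; simpl in hs; unfold AbsRing_ball, abs, minus, plus, opp in hs;
      simpl in hs. apply Rabs_def2 in hs. lra.
  - exists v. auto.
  - intros s t hs ht. simpl. exists (RInt f s t). split.
    + apply (RInt_correct f). apply hi; lra.
    + apply hP. unfold ball; simpl; unfold AbsRing_ball, abs, minus, plus, opp; simpl.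
      pose proof (RInt_nonneg_incr f s u v t hf hi ltac:(lra) ltac:(lra) huv ltac:(lra)).
      assert (RInt f s t <= S)
        by (apply hub; exists s, t; repeat split; lra).
      apply Rabs_def1; pose proof (cond_pos eps); lra.
Qed.

(** Seeing [Gamma] as a supremum reduces inequalities between its values to inequalities between
    proper integrals over a common interval. *)
Lemma Gamma_lub (x : R) : 0 < x ->
  is_lub (fun y => exists u v, 0 < u /\ u <= v /\ y = RInt (gamma_integrand x) u v)
    (Gamma x).
Proof.
  intros hx.
  destruct (completeness
    (fun y => exists u v, 0 < u /\ u <= v /\ y = RInt (gamma_integrand x) u v))
    as [S hS].
  - exists (3 * exp (x * ln (2 * x)) / x). intros y (u & v & hu & huv & ->).
    apply gamma_integral_bound; assumption.
  - exists (RInt (gamma_integrand x) 1 1), 1, 1. repeat split; lra.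
  - replace (Gamma x) with S; [exact hS | symmetry].
    apply (is_RInt_gen_unique (V := R_CompleteNormedModule) (gamma_integrand x)).
    apply is_RInt_gen_nonneg_lub; [ | | exact hS].
    + intros t _. left. apply gamma_integrand_pos.
    + intros s t. apply gamma_integrand_ex_RInt.
Qed.

Lemma Gamma_pos (x : R) : 0 < x -> 0 < Gamma x.
Proof.
  intros hx. apply Rlt_le_trans with (RInt (gamma_integrand x) 1 2).
  - apply RInt_gt_0; [lra | intros; apply gamma_integrand_pos | ].
    intros t ht. apply gamma_integrand_continuous. lra.
  - apply Gamma_lub; [exact hx | ]. exists 1, 2. repeat split; lra.
Qed.

(* Integrating [t^(x-1) (l - t^m)^2 e^(-t) >= 0] for every real [l] replaces
   Hoelder's inequality. *)
Lemma Gamma_quadratic (x m l : R) : 0 < x -> 0 < m -> 0 < l ->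
  2 * l * Gamma (x + m) <= l ^ 2 * Gamma x + Gamma (x + 2 * m).
Proof.
  intros hx hm hl.
  (* Isolating [Gamma (x + m)] lets the least-upper-bound property apply to it, while the two values
     on the right only need to be upper bounds. *)
  apply Rmult_le_reg_l with (/ (2 * l)); [apply Rinv_0_lt_compat; lra | ].
  replace (/ (2 * l) * (2 * l * Gamma (x + m))) with (Gamma (x + m)) by (field; lra).
  apply (proj2 (Gamma_lub (x + m) ltac:(lra))).
  intros y (u & v & hu & huv & ->).
  assert (hi : forall s, ex_RInt (gamma_integrand s) u v)
    by (intros s; apply gamma_integrand_ex_RInt; lra).
  assert (h0 : RInt (gamma_integrand x) u v <= Gamma x)
    by (apply Gamma_lub; [exact hx | exists u, v; repeat split; lra]).
  assert (h2 : RInt (gamma_integrand (x + 2 * m)) u v <= Gamma (x + 2 * m))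
    by (apply Gamma_lub; [lra | exists u, v; repeat split; lra]).
  pose proof (is_RInt_scal _ _ _ (2 * l) _ (RInt_correct _ _ _ (hi (x + m)))) as i1.
  pose proof (is_RInt_plus _ _ _ _ _ _
    (is_RInt_scal _ _ _ (l ^ 2) _ (RInt_correct _ _ _ (hi x)))
    (RInt_correct _ _ _ (hi (x + 2 * m)))) as i2.
  apply is_RInt_le with (3 := i2) in i1; [ | exact huv | ].
  - unfold plus, scal in i1; simpl in i1; unfold mult in i1; simpl in i1.
    apply Rmult_le_reg_l with (2 * l); [lra | ].
    rewrite <- Rmult_assoc, Rinv_r, Rmult_1_l by lra.
    nra.
  - intros t ht. unfold plus, scal; simpl; unfold mult; simpl.
    unfold gamma_integrand.
    replace (x + m - 1) with ((x - 1) + m) by ring.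
    replace (x + 2 * m - 1) with ((x - 1) + m + m) by ring.
    rewrite !Rpower_plus.
    assert (0 < Rpower t (x - 1) * exp (- t))
      by (apply Rmult_lt_0_compat; apply exp_pos).
    pose proof (Rmult_le_pos _ _ (Rlt_le _ _ H) (pow2_ge_0 (l - Rpower t m))).
    nra.
Qed.

(** [Gamma_quadratic] is taken at the minimizer [l = Gamma (x + m) / Gamma x] of the quadratic in
    [l]; the result says that its discriminant is not positive. *)
Lemma Gamma_log_convex (x m : R) : 0 < x -> 0 < m ->
  Gamma (x + m) ^ 2 <= Gamma x * Gamma (x + 2 * m).
Proof.
  intros hx hm.
  pose proof (Gamma_pos x hx). pose proof (Gamma_pos (x + m) ltac:(lra)).
  pose proof (Gamma_quadratic x m (Gamma (x + m) / Gamma x) hx hm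
    ltac:(apply Rdiv_lt_0_compat; assumption)) as hq.
  apply Rmult_le_compat_l with (r := Gamma x) in hq; [ | lra].
  replace (Gamma x * (2 * (Gamma (x + m) / Gamma x) * Gamma (x + m)))
    with (2 * Gamma (x + m) ^ 2) in hq by (field; lra).
  replace (Gamma x * ((Gamma (x + m) / Gamma x) ^ 2 * Gamma x + Gamma (x + 2 * m)))
    with (Gamma (x + m) ^ 2 + Gamma x * Gamma (x + 2 * m)) in hq by (field; lra).
  lra.
Qed.

(** * Coefficients of the Wright function *)

(** Comparison with the geometric series [u 0 * q ^ k]. It serves both the coefficient sums and the
    increments of a fixed-point iteration. *)
Lemma is_series_of_ratio (u : nat -> R) (q : R) : 0 <= q < 1 ->
  (forall k, 0 <= u k) -> (forall k, u (S k) <= q * u k) ->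
  ex_series u /\ Series u <= u 0%nat / (1 - q).
Proof.
  intros hq hu hr.
  assert (hb : forall k, 0 <= u k <= u 0%nat * q ^ k).
  { intros k. split; [apply hu | ]. induction k as [ | k IH]; simpl; [lra | ].
    pose proof (hr k).
    assert (q * u k <= q * (u 0%nat * q ^ k)) by (apply Rmult_le_compat_l; lra).
    lra. }
  assert (hg : is_series (fun k => u 0%nat * q ^ k) (u 0%nat / (1 - q))).
  { apply (is_series_scal (u 0%nat) (fun k => q ^ k) (/ (1 - q))).
    apply is_series_geom. rewrite Rabs_pos_eq; lra. }
  split.
  - apply (ex_series_le (V := R_CompleteNormedModule)) with (2 := ex_intro _ _ hg).
    intros k. change (norm (u k)) with (Rabs (u k)).
    rewrite Rabs_pos_eq; apply hb.
  - rewrite <- (is_series_unique _ _ hg). apply Series_le; [exact hb | ].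
    eexists; exact hg.
Qed.

Lemma wright_coeff_pos (mu a nu b : R) (k : nat) :
  0 < a -> 0 < b -> 0 < mu -> 0 < nu -> 0 < wright_coeff mu a nu b k.
Proof.
  intros ha hb hmu hnu. unfold wright_coeff.
  assert (hk := pos_INR k).
  apply Rdiv_lt_0_compat; apply Rmult_lt_0_compat; apply Gamma_pos; nra.
Qed.

Lemma wright_coeff_0 (mu a nu b : R) : 0 < a -> 0 < b ->
  wright_coeff mu a nu b 0 = 1.
Proof.
  intros ha hb. unfold wright_coeff. simpl.
  rewrite !Rmult_0_l, !Rplus_0_r.
  pose proof (Gamma_pos a ha). pose proof (Gamma_pos b hb).
  field; lra.
Qed.

(** The reciprocal of a product of two log-convex sequences is log-concave; [Gamma_log_convex] is
    used with step [mu] in one factor and [nu] in the other. *)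
Lemma wright_coeff_log_concave (mu a nu b : R) (k : nat) :
  0 < a -> 0 < b -> 0 < mu -> 0 < nu ->
  wright_coeff mu a nu b (S (S k)) * wright_coeff mu a nu b k
  <= wright_coeff mu a nu b (S k) ^ 2.
Proof.
  intros ha hb hmu hnu. unfold wright_coeff.
  assert (hk := pos_INR k). rewrite !S_INR.
  replace (a + (INR k + 1) * mu) with (a + INR k * mu + mu) by ring.
  replace (b + (INR k + 1) * nu) with (b + INR k * nu + nu) by ring.
  replace (a + (INR k + 1 + 1) * mu) with (a + INR k * mu + 2 * mu) by ring.
  replace (b + (INR k + 1 + 1) * nu) with (b + INR k * nu + 2 * nu) by ring.
  assert (hx : 0 < a + INR k * mu) by nra.
  assert (hy : 0 < b + INR k * nu) by nra.
  revert hx hy. generalize (a + INR k * mu) (b + INR k * nu). intros x y hx hy.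
  pose proof (Gamma_log_convex x mu hx hmu) as h1.
  pose proof (Gamma_log_convex y nu hy hnu) as h2.
  pose proof (Gamma_pos x hx). pose proof (Gamma_pos y hy).
  pose proof (Gamma_pos (x + mu) ltac:(lra)).
  pose proof (Gamma_pos (y + nu) ltac:(lra)).
  pose proof (Gamma_pos (x + 2 * mu) ltac:(lra)).
  pose proof (Gamma_pos (y + 2 * nu) ltac:(lra)).
  set (N := Gamma a * Gamma b).
  replace (N / (Gamma (x + 2 * mu) * Gamma (y + 2 * nu)) * (N / (Gamma x * Gamma y)))
    with (N ^ 2 * / ((Gamma x * Gamma (x + 2 * mu)) * (Gamma y * Gamma (y + 2 * nu))))
    by (field; lra).
  replace ((N / (Gamma (x + mu) * Gamma (y + nu))) ^ 2)
    with (N ^ 2 * / (Gamma (x + mu) ^ 2 * Gamma (y + nu) ^ 2)) by (field; lra).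
  apply Rmult_le_compat_l; [apply pow2_ge_0 | ].
  apply Rinv_le_contravar.
  - apply Rmult_lt_0_compat; apply pow_lt; assumption.
  - apply Rmult_le_compat; try apply pow2_ge_0; assumption.
Qed.

(** Log-concavity makes the successive ratios nonincreasing, so the first one bounds them all.
    Multiplying by [A k] keeps the induction free of division. *)
Lemma log_concave_ratio (A : nat -> R) : (forall k, 0 < A k) ->
  (forall k, A (S (S k)) * A k <= A (S k) ^ 2) ->
  forall k, A (S k) <= A 1%nat / A 0%nat * A k.
Proof.
  intros hp hl k. pose proof (hp 0%nat). induction k as [ | k IH].
  - right. field. lra.
  - pose proof (hp k). apply Rmult_le_reg_r with (A k); [assumption | ].
    pose proof (hl k). pose proof (hp (S k)).
    assert (A (S k) * A (S k) <= A (S k) * (A 1%nat / A 0%nat * A k))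
      by (apply Rmult_le_compat_l; lra).
    nra.
Qed.

(** * Numerical consequences of the bound by [2 / sqrt 5] *)

Lemma five_halves_lt_exp_1 : 5 / 2 < exp 1.
Proof.
  (* Three squarings starting from [9/8 <= exp (1/8)]: [81/64], then more than [8/5], then at least
     [64/25 > 5/2]. *)
  replace 1 with (1 / 8 + 1 / 8 + (1 / 8 + 1 / 8) + (1 / 8 + 1 / 8 + (1 / 8 + 1 / 8)))
    by field.
  rewrite !exp_plus.
  pose proof (exp_ineq1_le (1 / 8)).
  assert (h2 : 81 / 64 <= exp (1 / 8) * exp (1 / 8)) by nra.
  set (y := exp (1 / 8) * exp (1 / 8)) in *.
  assert (8 / 5 <= y * y) by nra. nra.
Qed.

(** Here [x] stands for [A_1], [r] for [A_2 / A_1] and [E] for [e]. The second conclusion is exactly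
    what makes the geometric bound [2 x / (1 - 3 r / 2)] less than [1]. *)
Lemma ratio_bound (x r E : R) : 0 < r <= x -> 5 / 2 < E ->
  2 * x + 3 * (E - 1) * (r * x) < 2 / sqrt 5 ->
  r < 7 / 25 /\ 2 * x < 1 - 3 / 2 * r.
Proof.
  intros hr hE h.
  assert (hs : 2 / sqrt 5 < 8945 / 10000).
  { assert (0 < sqrt 5) by (apply sqrt_lt_R0; lra).
    assert (sqrt 5 * sqrt 5 = 5) by (apply sqrt_sqrt; lra).
    apply Rmult_lt_reg_r with (sqrt 5); [assumption | ].
    replace (2 / sqrt 5 * sqrt 5) with 2 by (field; lra).
    nra. }
  assert (hx : 2 * x + 9 / 2 * (r * x) < 8945 / 10000).
  { assert (0 < r * x) by (apply Rmult_lt_0_compat; lra). nra. }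
  (* If [r >= 7/25], then also [x >= 7/25], and the left side of [hx] is at least [0.9128]. *)
  assert (hr2 : r < 7 / 25).
  { apply Rnot_le_lt. intros h7.
    assert (7 / 25 * (7 / 25) <= r * x) by (apply Rmult_le_compat; lra). lra. }
  split; [exact hr2 | ].
  (* Otherwise [2 x (1 + 9 r / 4) >= (1 - 3 r / 2) (1 + 9 r / 4)], which is concave in [r] and
     exceeds [0.94] at both ends of [[0, 7/25]], against [hx]. *)
  apply Rnot_le_lt. intros hc.
  assert (r * (1 - 3 / 2 * r) <= r * (2 * x)) by (apply Rmult_le_compat_l; lra).
  nra.
Qed.

(** The index [k] refers to the term in [z^(k+2)]. The second sum will be a Lipschitz constant for
    [f - id]; the first controls the quadratic Taylor remainder. *)
Lemma wright_weights (a b mu nu : R) :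
  0 < a -> 0 < b -> 0 < mu -> 0 < nu ->
  2 * Gamma a * Gamma b / (Gamma (a + mu) * Gamma (b + nu))
  - 3 * (1 - exp 1) * Gamma a * Gamma b / (Gamma (a + 2 * mu) * Gamma (b + 2 * nu))
  < 2 / sqrt 5 ->
  ex_series (fun k => (INR k + 2) * (INR k + 1) * wright_coeff mu a nu b (S k)) /\
  Series (fun k => (INR k + 2) * wright_coeff mu a nu b (S k)) < 1.
Proof.
  intros ha hb hmu hnu h.
  set (A := wright_coeff mu a nu b).
  assert (hp : forall k, 0 < A k) by (intros k; apply wright_coeff_pos; assumption).
  assert (hl : forall k, A (S (S k)) * A k <= A (S k) ^ 2)
    by (intros k; apply wright_coeff_log_concave; assumption).
  assert (h0 : A 0%nat = 1) by (apply wright_coeff_0; assumption).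
  pose proof (log_concave_ratio (fun k => A (S k)) (fun k => hp (S k)) (fun k => hl (S k)))
    as hr. cbv beta in hr.
  set (r := A 2%nat / A 1%nat) in hr.
  pose proof (hp 1%nat) as h1. pose proof (hp 2%nat) as h2.
  assert (hr0 : 0 < r) by (apply Rdiv_lt_0_compat; assumption).
  assert (hA2 : A 2%nat = r * A 1%nat) by (unfold r; field; lra).
  destruct (ratio_bound (A 1%nat) r (exp 1)) as [hr7 hx].
  (* [r <= A 1] is log-concavity at [k = 0], since [A 0 = 1]. *)
  - split; [exact hr0 | ]. pose proof (hl 0%nat) as hl0. rewrite h0, hA2 in hl0.
    apply Rmult_le_reg_r with (A 1%nat); [assumption | ]. lra.
  - exact five_halves_lt_exp_1.
  - rewrite <- hA2. revert h. apply Rle_lt_trans. right.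
    unfold A, wright_coeff. simpl INR. rewrite Rmult_1_l, Rmult_1_l.
    replace (1 + 1) with 2 by ring. unfold Rdiv. ring.
  - split.
    (* The weight ratio [(k + 3) / (k + 1)] is largest at [k = 0], where it is [3]; and
       [3 r < 21/25]. *)
    + apply (is_series_of_ratio _ (3 * r)); [lra | intros k; pose proof (pos_INR k) as hk;
        pose proof (hp (S k)) as hpk .. ].
      * apply Rmult_le_pos; nra.
      * rewrite S_INR.
        apply Rle_trans with ((INR k + 1 + 2) * (INR k + 1 + 1) * (r * A (S k))).
        { apply Rmult_le_compat_l; [nra | apply hr]. }
        assert (0 <= r * A (S k)) by nra.
        assert ((INR k + 1 + 2) * (INR k + 1 + 1) <= 3 * ((INR k + 2) * (INR k + 1)))
          by nra.
        nra.
    (* With the linear weight, the ratio [(k + 3) / (k + 2)] is at most [3/2]. *)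
    + apply Rle_lt_trans with ((INR 0 + 2) * A 1%nat / (1 - 3 / 2 * r)).
      * apply (is_series_of_ratio (fun k => (INR k + 2) * A (S k)) (3 / 2 * r));
          [lra | intros k; pose proof (pos_INR k) as hk;
          pose proof (hp (S k)) as hpk .. ].
        { apply Rmult_le_pos; lra. }
        rewrite S_INR.
        apply Rle_trans with ((INR k + 1 + 2) * (r * A (S k))).
        { apply Rmult_le_compat_l; [lra | apply hr]. }
        assert (0 <= r * A (S k)) by nra. nra.
      * simpl INR. rewrite Rplus_0_l.
        apply Rmult_lt_reg_r with (1 - 3 / 2 * r); [lra | ].
        replace (2 * A 1%nat / (1 - 3 / 2 * r) * (1 - 3 / 2 * r)) with (2 * A 1%nat)
          by (field; lra). lra.
Qed.

(** * Complex series and powers *)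

Local Notation is_Cseries :=
  (is_series (K := C_AbsRing) (V := C_NormedModule)).

(** Every later estimate on the function and its derivative goes through this passage from termwise
    bounds to sums. *)
Lemma is_Cseries_Cmod_le (u : nat -> C) (v : nat -> R) (l : C) (m : R) :
  is_Cseries u l -> is_series v m -> (forall k, Cmod (u k) <= v k) -> Cmod l <= m.
Proof.
  intros hu hv huv.
  apply (is_lim_seq_le (fun n => Cmod (sum_n u n)) (sum_n v) (Cmod l) m).
  - intros n. apply Rle_trans with (sum_n (fun k => Cmod (u k)) n).
    + apply (norm_sum_n_m (K := C_AbsRing) (V := C_NormedModule)).
    + apply sum_n_m_le. exact huv.
  - apply (filterlim_comp _ _ _ _ _ eventually (locally (T := C_NormedModule) l) _ hu).
    apply (filterlim_norm (K := C_AbsRing) (V := C_NormedModule)).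
  - exact hv.
Qed.

Lemma ex_Cseries_Cmod (u : nat -> C) :
  ex_series (fun k => Cmod (u k)) -> exists l : C, is_Cseries u l.
Proof.
  intros h.
  apply (ex_series_le (K := C_AbsRing) (V := C_CompleteNormedModule) u _
    (fun k => Rle_refl _) h).
Qed.

Lemma iota_Cseries (u : nat -> C) (l : C) : is_Cseries u l ->
  iota (T := C_CompleteNormedModule) (is_Cseries u) = l.
Proof.
  intros h.
  apply (iota_filterlim_locally (K := C_AbsRing) (V := C_CompleteNormedModule)
    (F := eventually) (sum_n (G := C_NormedModule) u) l h).
Qed.

Lemma Cmod_minus_sym (x y : C) : Cmod (x - y) = Cmod (y - x).
Proof. rewrite <- Cmod_opp. f_equal. ring. Qed.

Lemma Cmod_minus_triangle (x y z : C) : Cmod (x - z) <= Cmod (x - y) + Cmod (y - z).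
Proof.
  replace (x - z)%C with ((x - y) + (y - z))%C by ring. apply Cmod_triangle.
Qed.

Lemma Cmod_minus_le (x y : C) : Cmod (x - y) <= Cmod x + Cmod y.
Proof. rewrite <- (Cmod_opp y). apply Cmod_triangle. Qed.

Lemma Cmod_ge_minus (x y : C) : Cmod x - Cmod y <= Cmod (x + y).
Proof.
  pose proof (Cmod_minus_le (x + y) y) as h.
  replace (x + y - y)%C with x in h by ring. lra.
Qed.

Lemma Cmod_eq_minus (x y : C) : Cmod (x - y) <= 0 -> x = y.
Proof.
  intros h. replace x with ((x - y) + y)%C by ring.
  rewrite (Cmod_eq_0 (x - y)); [ring | ].
  apply Rle_antisym; [exact h | apply Cmod_ge_0].
Qed.

Lemma Cmod_pow_le_1 (x : C) (n : nat) : Cmod x <= 1 -> Cmod (x ^ n) <= 1.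
Proof.
  intros h. rewrite Cmod_pow, <- (pow1 n). apply pow_incr.
  split; [apply Cmod_ge_0 | exact h].
Qed.

Lemma Cpow_lipschitz (x y : C) (n : nat) : Cmod x <= 1 -> Cmod y <= 1 ->
  Cmod (x ^ n - y ^ n) <= INR n * Cmod (x - y).
Proof.
  intros hx hy. induction n as [ | n IH].
  - simpl. replace (1 - 1)%C with (RtoC 0) by ring. rewrite Cmod_0. lra.
  - rewrite S_INR.
    replace (x ^ S n - y ^ S n)%C with (x * (x ^ n - y ^ n) + (x - y) * y ^ n)%C
      by (rewrite !Cpow_S; ring).
    eapply Rle_trans; [apply Cmod_triangle | ]. rewrite !Cmod_mult.
    pose proof (Cmod_pow_le_1 y n hy). pose proof (Cmod_ge_0 (x - y)).
    pose proof (Cmod_ge_0 (x ^ n - y ^ n)). pose proof (Cmod_ge_0 x).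
    nra.
Qed.

(** Each induction step adds at most [(n + 1) |x - y|^2] to the error. That would give half the
    stated constant; the stated one matches the weights [(k + 2) (k + 1)] at [n = k + 1]. *)
Lemma Cpow_taylor (x y : C) (n : nat) : Cmod x <= 1 -> Cmod y <= 1 ->
  Cmod (x ^ S n - y ^ S n - RtoC (INR n + 1) * y ^ n * (x - y))
  <= (INR n + 1) * INR n * Cmod (x - y) ^ 2.
Proof.
  intros hx hy. induction n as [ | n IH].
  - simpl. replace (x * 1 - y * 1 - RtoC (0 + 1) * 1 * (x - y))%C with (RtoC 0)
      by (rewrite Rplus_0_l; ring).
    rewrite Cmod_0. lra.
  - rewrite S_INR.
    replace (x ^ S (S n) - y ^ S (S n) - RtoC (INR n + 1 + 1) * y ^ S n * (x - y))%C
      with (x * (x ^ S n - y ^ S n - RtoC (INR n + 1) * y ^ n * (x - y))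
            + RtoC (INR n + 1) * y ^ n * ((x - y) * (x - y)))%C
      by (rewrite !Cpow_S, (RtoC_plus (INR n + 1) 1); ring).
    eapply Rle_trans; [apply Cmod_triangle | ]. rewrite !Cmod_mult, Cmod_R.
    pose proof (pos_INR n).
    rewrite (Rabs_pos_eq (INR n + 1)) by lra.
    pose proof (Cmod_pow_le_1 y n hy).
    set (e := Cmod (x ^ S n - y ^ S n - RtoC (INR n + 1) * y ^ n * (x - y))) in *.
    pose proof (Cmod_ge_0 (x - y)). set (d := Cmod (x - y)) in *.
    pose proof (Cmod_ge_0 x).
    assert (0 <= e) by apply Cmod_ge_0.
    assert (Cmod x * e <= 1 * e) by (apply Rmult_le_compat_r; lra).
    assert (0 <= d * d) by nra.
    assert ((INR n + 1) * Cmod (y ^ n) * (d * d) <= (INR n + 1) * 1 * (d * d)).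
    { apply Rmult_le_compat_r; [assumption | apply Rmult_le_compat_l; lra]. }
    nra.
Qed.

(** * Fixed points and a contraction estimate *)

Lemma closed_ball_fixed_point (F : C -> C) (c : C) (delta q : R) :
  0 <= delta -> 0 <= q < 1 ->
  (forall x, Cmod (x - c) <= delta -> Cmod (F x - c) <= delta) ->
  (forall x y, Cmod (x - c) <= delta -> Cmod (y - c) <= delta ->
     Cmod (F x - F y) <= q * Cmod (x - y)) ->
  exists x, Cmod (x - c) <= delta /\ F x = x.
Proof.
  intros hd hq hmaps hlip.
  set (X := fun n => Nat.iter n F c).
  assert (hX : forall n, Cmod (X n - c) <= delta).
  { induction n as [ | n IH]; simpl; [ | apply hmaps, IH].
    replace (c - c)%C with (RtoC 0) by ring. rewrite Cmod_0. exact hd. }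
  (* The partial sums of these increments are [X (S n) - c], so the iterates converge because the
     series of increments converges absolutely. *)
  set (u := fun n => (X (S n) - X n)%C).
  destruct (is_series_of_ratio (fun n => Cmod (u n)) q hq) as [hex _].
  { intros n. apply Cmod_ge_0. }
  { intros n. apply (hlip (X (S n)) (X n)); [apply (hX (S n)) | apply hX]. }
  destruct (ex_Cseries_Cmod u hex) as [l hl].
  assert (hsum : forall n, sum_n (G := C_NormedModule) u n = (X (S n) - c)%C).
  { induction n as [ | n IH].
    - rewrite sum_O. reflexivity.
    - rewrite sum_Sn, IH. unfold u, plus; simpl; unfold Cplus, Cminus; simpl.
      change ((X (S n) - c) + (X (S (S n)) - X (S n)) = X (S (S n)) - c)%C. ring. }
  assert (hlim : is_lim_seq (fun n => Cmod (X (S n) - (c + l))) 0).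
  { apply (is_lim_seq_ext (fun n => Cmod (sum_n (G := C_NormedModule) u n - l))).
    { intros n. rewrite hsum. f_equal. ring. }
    replace 0 with (Cmod (l - l))
      by (replace (l - l)%C with (RtoC 0) by ring; apply Cmod_0).
    apply (filterlim_comp _ _ _ (fun n => sum_n (G := C_NormedModule) u n)
      (fun s => Cmod (s - l)) eventually (locally (T := C_NormedModule) l) _ hl).
    apply (filterlim_comp _ _ _ (fun s : C => (s - l)%C) Cmod _
      (locally (T := C_NormedModule) (l - l)%C)).
    - apply (continuous_minus (K := C_AbsRing) (V := C_NormedModule)
        (fun s : C_NormedModule => s) (fun _ => l) l);
        [apply continuous_id | apply continuous_const].
    - apply (filterlim_norm (K := C_AbsRing) (V := C_NormedModule)). }
  exists (c + l)%C.
  assert (hball : Cmod (c + l - c) <= delta).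
  { apply (is_lim_seq_le (fun _ => Cmod (c + l - c))
      (fun n => delta + Cmod (X (S n) - (c + l))) (Cmod (c + l - c)) delta).
    - intros n. eapply Rle_trans; [apply (Cmod_minus_triangle _ (X (S n))) | ].
      rewrite (Cmod_minus_sym (c + l)). pose proof (hX (S n)). lra.
    - apply is_lim_seq_const.
    - rewrite <- (Rplus_0_r delta) at 1.
      apply (is_lim_seq_plus' _ _ delta 0); [apply is_lim_seq_const | exact hlim]. }
  split; [exact hball | ].
  apply Cmod_eq_minus.
  (* The distance from [F (c + l)] to [c + l] is compared with the distances of two consecutive
     iterates to the limit, both of which tend to [0]. *)
  apply (is_lim_seq_le (fun _ => Cmod (F (c + l)%C - (c + l)))
    (fun n => Cmod (X (S n) - (c + l)) + Cmod (X (S (S n)) - (c + l)))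
    (Cmod (F (c + l)%C - (c + l))) 0).
  - intros n. eapply Rle_trans; [apply (Cmod_minus_triangle _ (X (S (S n)))) | ].
    apply Rplus_le_compat_r.
    eapply Rle_trans; [apply (hlip (c + l)%C (X (S n)) hball (hX (S n))) | ].
    rewrite Cmod_minus_sym. pose proof (Cmod_ge_0 (X (S n) - (c + l))). nra.
  - apply is_lim_seq_const.
  - rewrite <- (Rplus_0_r 0).
    apply is_lim_seq_plus'; [exact hlim | ].
    apply (is_lim_seq_incr_1 (fun n => Cmod (X (S n) - (c + l)))). exact hlim.
Qed.

(** Expanding [|P - Q|^2 <= |Q|^2] gives [2 Re (P conj Q) >= |P|^2], hence
    [|P - eps Q|^2 <= s |P|^2] with [s = 1 - eps + eps^2 M^2]. The root is removed by
    [sqrt s <= (1 + s) / 2]. *)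
Lemma Cmod_contract (P Q : C) (eps M : R) :
  0 <= eps -> Cmod (P - Q) <= Cmod Q -> Cmod Q <= M * Cmod P ->
  Cmod (P - RtoC eps * Q) <= Cmod P * (1 - eps / 2 + eps ^ 2 * M ^ 2 / 2).
Proof.
  intros he hPQ hQ.
  pose proof (Cmod_ge_0 P). pose proof (Cmod_ge_0 Q). pose proof (Cmod_ge_0 (P - Q)).
  assert (hsq : Cmod (P - Q) ^ 2 <= Cmod Q ^ 2) by (apply pow_incr; lra).
  assert (hQ2 : Cmod Q ^ 2 <= (M * Cmod P) ^ 2) by (apply pow_incr; lra).
  assert (h : Cmod (P - RtoC eps * Q) ^ 2
    <= Cmod P ^ 2 * (1 - eps + eps ^ 2 * M ^ 2)).
  { rewrite Cmod2_alt in *. rewrite (Cmod2_alt Q) in *. rewrite (Cmod2_alt P) in *.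
    rewrite Rpow_mult_distr, Cmod2_alt in hQ2.
    destruct P as [p1 p2], Q as [q1 q2]. simpl in *.
    assert (eps * eps * (q1 * (q1 * 1) + q2 * (q2 * 1))
      <= eps * eps * (M * (M * 1) * (p1 * (p1 * 1) + p2 * (p2 * 1))))
      by (apply Rmult_le_compat_l; nra).
    nra. }
  destruct (Req_dec (Cmod P) 0) as [h0 | h0].
  { rewrite h0 in *. pose proof (Cmod_ge_0 (P - RtoC eps * Q)). nra. }
  set (s := 1 - eps + eps ^ 2 * M ^ 2) in *.
  replace (1 - eps / 2 + eps ^ 2 * M ^ 2 / 2) with ((1 + s) / 2) by (unfold s; field).
  assert (hs : 0 <= s).
  { apply Rmult_le_reg_l with (Cmod P ^ 2); [apply pow_lt; lra | ].
    rewrite Rmult_0_r. eapply Rle_trans; [apply pow2_ge_0 | exact h]. }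
  apply Rsqr_incr_0; [unfold Rsqr | apply Cmod_ge_0 | apply Rmult_le_pos; lra].
  replace (Cmod P * ((1 + s) / 2) * (Cmod P * ((1 + s) / 2)))
    with (Cmod P ^ 2 * ((1 + s) / 2) ^ 2) by ring.
  assert (s <= ((1 + s) / 2) ^ 2) by (pose proof (pow2_ge_0 (1 - s)); nra).
  assert (Cmod P ^ 2 * s <= Cmod P ^ 2 * ((1 + s) / 2) ^ 2)
    by (apply Rmult_le_compat_l; [apply pow2_ge_0 | assumption]).
  lra.
Qed.

(** * Starlikeness of perturbations of the identity *)

(** What starlikeness needs, in quantitative form: [f'] is the derivative, [sigma] a Lipschitz
    constant of [f - id], [K] a Taylor constant. Where [f z] is nonzero, the last clause puts
    [z f' z / f z] in the closed disk of centre [1] and radius [1], hence in the right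
    half-plane. *)
Definition near_identity (f f' : C -> C) (sigma K : R) : Prop :=
  0 <= sigma < 1 /\ 0 <= K /\ f 0 = 0 /\
  (forall z w, Cmod z <= 1 -> Cmod w <= 1 ->
     Cmod (f z - f w - (z - w)) <= sigma * Cmod (z - w)) /\
  (forall z w, Cmod z <= 1 -> Cmod w <= 1 ->
     Cmod (f z - f w - f' w * (z - w)) <= K * Cmod (z - w) ^ 2) /\
  (forall z, Cmod z <= 1 -> 1 - sigma <= Cmod (f' z)) /\
  (forall z, Cmod z <= 1 -> Cmod (f z - z * f' z) <= Cmod (f z)).

Lemma near_identity_is_derive {f f' : C -> C} {sigma K : R}
  (hf : near_identity f f' sigma K) (z : C) : Cmod z < 1 ->
  is_derive (K := C_AbsRing) (V := C_NormedModule) f z (f' z).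
Proof.
  pose proof hf as (_ & hK & _ & _ & htaylor & _). intros hz. split.
  { apply (is_linear_scal_l (K := C_AbsRing) (V := C_NormedModule)). }
  intros x hx.
  apply (is_filter_lim_locally_unique (K := C_AbsRing)
    (V := AbsRing_NormedModule C_AbsRing)) in hx. subst x.
  intros eps.
  (* The first bound keeps [y] in the disk, the second makes [K |y - z| <= eps]; [K + 1] avoids
     dividing by [0]. *)
  assert (he : 0 < Rmin (1 - Cmod z) (eps / (K + 1))).
  { apply Rmin_glb_lt; [lra | ].
    apply Rdiv_lt_0_compat; [apply cond_pos | lra]. }
  exists (mkposreal _ he).
  enough (h : forall y : C, Cmod (y - z) < Rmin (1 - Cmod z) (eps / (K + 1)) ->
    Cmod (f y - f z - (y - z) * f' z) <= eps * Cmod (y - z)) by exact h.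
  intros y hy.
  assert (h1 := Rlt_le_trans _ _ _ hy (Rmin_l _ _)).
  assert (h2 := Rlt_le_trans _ _ _ hy (Rmin_r _ _)).
  pose proof (Cmod_triangle z (y - z)) as h3.
  replace (z + (y - z))%C with y in h3 by ring.
  pose proof (htaylor y z ltac:(lra) ltac:(lra)) as h4.
  rewrite (Cmult_comm (y - z)).
  pose proof (Cmod_ge_0 (y - z)).
  apply Rlt_div_r in h2; [ | lra].
  eapply Rle_trans; [exact h4 | ]. nra.
Qed.

Lemma near_identity_lower {f f' : C -> C} {sigma K : R}
  (hf : near_identity f f' sigma K) (z w : C) : Cmod z <= 1 -> Cmod w <= 1 ->
  (1 - sigma) * Cmod (z - w) <= Cmod (f z - f w).
Proof.
  pose proof hf as (_ & _ & _ & hlip & _). intros hz hw.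
  pose proof (hlip z w hz hw).
  pose proof (Cmod_ge_minus (z - w) (f z - f w - (z - w))) as h.
  replace (z - w + (f z - f w - (z - w)))%C with (f z - f w)%C in h by ring. lra.
Qed.

Lemma near_identity_injective {f f' : C -> C} {sigma K : R}
  (hf : near_identity f f' sigma K) (z w : C) : Cmod z <= 1 -> Cmod w <= 1 ->
  f z = f w -> z = w.
Proof.
  pose proof hf as ([_ hs] & _). intros hz hw heq.
  pose proof (near_identity_lower hf z w hz hw) as h.
  rewrite heq in h. replace (f w - f w)%C with (RtoC 0) in h by ring.
  rewrite Cmod_0 in h. apply Cmod_eq_minus. nra.
Qed.

Lemma near_identity_upper {f f' : C -> C} {sigma K : R}
  (hf : near_identity f f' sigma K) (z : C) : Cmod z <= 1 -> Cmod (f z) <= 2 * Cmod z.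
Proof.
  pose proof hf as (hs & _ & h0 & hlip & _). intros hz.
  pose proof (hlip z 0 hz ltac:(rewrite Cmod_0; lra)) as h.
  rewrite h0 in h.
  replace (z - 0)%C with z in h by ring. replace (f z - 0)%C with (f z) in h by ring.
  pose proof (Cmod_triangle (f z - z) z) as h2.
  replace (f z - z + z)%C with (f z) in h2 by ring.
  pose proof (Cmod_ge_0 z). nra.
Qed.

(** A solution of [f x = y] is a fixed point of [x - (f x - y)]. This map contracts by [sigma] and
    preserves the ball, because [(1 - sigma) delta + sigma delta = delta]. *)
Lemma near_identity_local_surjective {f f' : C -> C} {sigma K : R}
  (hf : near_identity f f' sigma K) (z y : C) (delta : R) :
  0 <= delta -> Cmod z + delta <= 1 -> Cmod (y - f z) <= (1 - sigma) * delta ->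
  exists x, Cmod (x - z) <= delta /\ f x = y.
Proof.
  pose proof hf as (hs & _ & _ & hlip & _). intros hd hz hy.
  assert (hin : forall x, Cmod (x - z) <= delta -> Cmod x <= 1).
  { intros x hx. pose proof (Cmod_triangle z (x - z)) as h.
    replace (z + (x - z))%C with x in h by ring. lra. }
  assert (hzin : Cmod z <= 1) by lra.
  destruct (closed_ball_fixed_point (fun x => x - (f x - y))%C z delta sigma hd hs)
    as (x & hx & hfix).
  - intros x hx.
    replace (x - (f x - y) - z)%C with ((y - f z) - (f x - f z - (x - z)))%C by ring.
    eapply Rle_trans; [apply Cmod_minus_le | ].
    pose proof (hlip x z (hin x hx) hzin).
    assert (sigma * Cmod (x - z) <= sigma * delta) by (apply Rmult_le_compat_l; lra).
    lra.
  - intros x x' hx hx'.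
    replace (x - (f x - y) - (x' - (f x' - y)))%C
      with (- (f x - f x' - (x - x')))%C by ring.
    rewrite Cmod_opp. apply hlip; apply hin; assumption.
  - exists x. split; [exact hx | ].
    replace (f x) with (x - (x - (f x - y)) + y)%C by ring.
    rewrite hfix. ring.
Qed.

(* One Newton step from [z] towards [(1 - eps) f z] moves to
   [z (1 - eps q)] with [q = f z / (z f' z)], and [|f z - z f' z| <= |f z|]
   says that [Re q >= 1/2]; the admissible [eps] is uniform in [|z| <= rho]. *)
Lemma near_identity_shrink {f f' : C -> C} {sigma K : R}
  (hf : near_identity f f' sigma K) (rho : R) : rho < 1 ->
  exists eps0, 0 < eps0 < 1 /\
  forall z eps, Cmod z <= rho -> 0 <= eps <= eps0 ->
  exists x, Cmod x <= Cmod z /\ f x = (RtoC (1 - eps) * f z)%C.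
Proof.
  intros hrho. pose proof hf as (hs & hK & h0 & hlip & htaylor & hder & hstar).
  destruct (Rlt_le_dec rho 0) as [hneg | hrho0].
  { exists (1 / 2). split; [lra | ]. intros z eps hz.
    pose proof (Cmod_ge_0 z). lra. }
  set (kap := 1 - sigma). assert (hk : 0 < kap <= 1) by (unfold kap; lra).
  assert (hk3 : 0 < kap ^ 3 <= kap).
  { split; [apply pow_lt; lra | ]. assert (kap * kap <= 1) by nra.
    replace (kap ^ 3) with (kap * (kap * kap)) by ring. nra. }
  (* Chosen to satisfy both [4 eps <= kap (1 - rho)], which keeps the ball around [z] inside the
     disk, and [eps (4 kap + 8 K) <= kap^3], which is [hfin]. *)
  exists (kap ^ 3 * (1 - rho) / (4 + 8 * K)).
  assert (hden : 0 < 4 + 8 * K) by lra.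
  split.
  { split.
    - apply Rdiv_lt_0_compat; [apply Rmult_lt_0_compat; lra | exact hden].
    - apply Rlt_div_l; [exact hden | ]. nra. }
  intros z eps hz [he he0].
  apply Rle_div_r in he0; [ | exact hden].
  pose proof (Cmod_ge_0 z) as hr0. set (r := Cmod z) in *.
  assert (hz1 : Cmod z <= 1) by (fold r; lra).
  pose proof (near_identity_upper hf z hz1) as hup. fold r in hup.
  (* The target differs from [f z] by [eps f z], of modulus at most [2 eps r = kap delta]. *)
  set (delta := 2 * eps * r / kap).
  assert (hkd : kap * delta = 2 * eps * r) by (unfold delta; field; lra).
  assert (hd : 0 <= delta).
  { apply Rmult_le_pos; [nra | left; apply Rinv_0_lt_compat; lra]. }
  assert (hek : eps * 4 <= kap * (1 - rho)) by nra.
  destruct (near_identity_local_surjective hf z (RtoC (1 - eps) * f z)%C delta)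
    as (x & hx & hfx); [exact hd | | | ].
  { fold r. apply Rmult_le_reg_l with kap; [lra | ].
    assert (2 * eps * r <= 2 * eps) by nra. nra. }
  { replace (RtoC (1 - eps) * f z - f z)%C with (- (RtoC eps * f z))%C
      by (rewrite RtoC_minus; ring).
    rewrite Cmod_opp, Cmod_mult, Cmod_R, Rabs_pos_eq by exact he.
    fold kap. rewrite hkd. nra. }
  exists x. split; [ | exact hfx].
  assert (hx1 : Cmod x <= 1).
  { pose proof (Cmod_triangle z (x - z)) as h.
    replace (z + (x - z))%C with x in h by ring. fold r in h.
    assert (delta <= 1 - rho); [ | lra].
    apply Rmult_le_reg_l with kap; [lra | ].
    assert (2 * eps * r <= 2 * eps) by nra. nra. }
  pose proof (hder z hz1) as hD. fold kap in hD.
  pose proof (htaylor x z hx1 hz1) as ht. rewrite hfx in ht.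
  replace (RtoC (1 - eps) * f z - f z - f' z * (x - z))%C
    with (- (f' z * x - (z * f' z - RtoC eps * f z)))%C in ht
    by (rewrite RtoC_minus; ring).
  rewrite Cmod_opp in ht.
  assert (hc : Cmod (z * f' z - RtoC eps * f z)
    <= Cmod (z * f' z) * (1 - eps / 2 + eps ^ 2 * (2 / kap) ^ 2 / 2)).
  { apply Cmod_contract; [exact he | | ].
    - rewrite Cmod_minus_sym. apply hstar. exact hz1.
    - rewrite Cmod_mult. fold r.
      replace (2 / kap * (r * Cmod (f' z))) with (2 * r * (Cmod (f' z) / kap))
        by (field; lra).
      assert (1 <= Cmod (f' z) / kap) by (apply Rle_div_r; lra).
      nra. }
  rewrite Cmod_mult in hc. fold r in hc.
  set (D := Cmod (f' z)) in *.
  assert (hdd : K * Cmod (x - z) ^ 2 <= K * delta ^ 2).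
  { apply Rmult_le_compat_l; [exact hK | ].
    apply pow_incr. split; [apply Cmod_ge_0 | exact hx]. }
  assert (hDx : D * Cmod x
    <= r * D * (1 - eps / 2 + eps ^ 2 * (2 / kap) ^ 2 / 2) + K * delta ^ 2).
  { unfold D. rewrite <- Cmod_mult.
    pose proof (Cmod_triangle (f' z * x - (z * f' z - RtoC eps * f z))
      (z * f' z - RtoC eps * f z)) as h.
    replace (f' z * x - (z * f' z - RtoC eps * f z) + (z * f' z - RtoC eps * f z))%C
      with (f' z * x)%C in h by ring.
    fold D. lra. }
  (* The bounds [r <= 1] and [kap <= D] turn the Taylor error into a multiple of [r D]; keeping the
     factor [r] lets the gain absorb it even near [0]. *)
  assert (hKd : K * delta ^ 2 <= r * D * (4 * K * eps ^ 2 / kap ^ 3)).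
  { apply Rle_trans with (r * kap * (4 * K * eps ^ 2 / kap ^ 3)).
    - replace (K * delta ^ 2) with (r * r * (4 * K * eps ^ 2 / kap ^ 2))
        by (unfold delta; field; lra).
      replace (r * kap * (4 * K * eps ^ 2 / kap ^ 3))
        with (r * (4 * K * eps ^ 2 / kap ^ 2)) by (field; lra).
      assert (0 <= 4 * K * eps ^ 2 / kap ^ 2).
      { apply Rmult_le_pos; [ | left; apply Rinv_0_lt_compat, pow_lt; lra].
        apply Rmult_le_pos; [lra | apply pow2_ge_0]. }
      apply Rmult_le_compat_r; [assumption | ]. nra.
    - apply Rmult_le_compat_r.
      + apply Rmult_le_pos; [ | left; apply Rinv_0_lt_compat; lra].
        apply Rmult_le_pos; [lra | apply pow2_ge_0].
      + apply Rmult_le_compat_l; lra. }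
  (* Both errors are quadratic in [eps], so the linear gain [eps / 2] dominates them. *)
  assert (hfin : eps ^ 2 * (2 / kap) ^ 2 / 2 + 4 * K * eps ^ 2 / kap ^ 3 <= eps / 2).
  { replace (eps ^ 2 * (2 / kap) ^ 2 / 2 + 4 * K * eps ^ 2 / kap ^ 3)
      with (eps * (eps * (2 * kap + 4 * K) / kap ^ 3)) by (field; lra).
    replace (eps / 2) with (eps * (1 / 2)) by field.
    apply Rmult_le_compat_l; [exact he | ].
    apply Rle_div_l; [lra | ]. nra. }
  apply Rmult_le_reg_l with D; [lra | ].
  assert (0 <= r * D) by (apply Rmult_le_pos; lra).
  nra.
Qed.

(** Shrinking by [1 - eps0] repeatedly reaches every [t > 0] in finitely many steps. Since moduli
    never increase, one [eps0], taken for the radius [|z|], serves throughout. *)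
Lemma near_identity_segment {f f' : C -> C} {sigma K : R}
  (hf : near_identity f f' sigma K) (z : C) (t : R) : Cmod z < 1 -> 0 <= t <= 1 ->
  exists x, Cmod x < 1 /\ f x = (RtoC t * f z)%C.
Proof.
  intros hz ht.
  destruct (Req_dec t 0) as [-> | ht0].
  { exists 0. rewrite Cmod_0. split; [lra | ].
    destruct hf as (_ & _ & h0 & _). rewrite h0. ring. }
  destruct (near_identity_shrink hf (Cmod z) hz) as (eps0 & heps0 & hstep).
  assert (hiter : forall n s x, Cmod x <= Cmod z -> (1 - eps0) ^ n <= s <= 1 ->
    exists y, Cmod y <= Cmod x /\ f y = (RtoC s * f x)%C).
  { induction n as [ | n IH]; intros s x hx hs.
    - simpl in hs. exists x. split; [lra | ]. replace s with 1 by lra. ring.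
    - destruct (Rle_lt_dec (1 - eps0) s) as [hbig | hsmall].
      (* A remaining factor of at least [1 - eps0] takes a single step; otherwise a full step is
         made and [s / (1 - eps0)] remains. *)
      + destruct (hstep x (1 - s) hx ltac:(lra)) as (y & hy & hfy).
        exists y. split; [exact hy | ]. rewrite hfy. do 2 f_equal. ring.
      + destruct (hstep x eps0 hx ltac:(lra)) as (y & hy & hfy).
        destruct (IH (s / (1 - eps0)) y ltac:(lra)) as (y' & hy' & hfy').
        { split; [apply Rle_div_r | apply Rle_div_l]; simpl in hs; lra. }
        exists y'. split; [lra | ].
        rewrite hfy', hfy, Cmult_assoc, <- RtoC_mult. do 2 f_equal. field. lra. }
  destruct (pow_lt_1_zero (1 - eps0) ltac:(rewrite Rabs_pos_eq; lra) t ltac:(lra))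
    as [N hN].
  pose proof (hN N (le_n _)) as hNN.
  rewrite Rabs_pos_eq in hNN by (apply pow_le; lra).
  destruct (hiter N t z (Rle_refl _) ltac:(lra)) as (x & hx & hfx).
  exists x. split; [lra | exact hfx].
Qed.

Lemma near_identity_image_open {f f' : C -> C} {sigma K : R}
  (hf : near_identity f f' sigma K) : open (T := C_UniformSpace) (image unit_disk f).
Proof.
  intros w (z & hz & <-). unfold unit_disk in hz.
  pose proof hf as (hs & _).
  (* Passes from the product neighbourhoods of [C] to balls for the modulus. *)
  apply locally_C.
  assert (he : 0 < (1 - sigma) * ((1 - Cmod z) / 2)) by (apply Rmult_lt_0_compat; lra).
  exists (mkposreal _ he).
  enough (h : forall y : C, Cmod (y - f z) < (1 - sigma) * ((1 - Cmod z) / 2) ->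
    image unit_disk f y) by exact h.
  intros y hy.
  destruct (near_identity_local_surjective hf z y ((1 - Cmod z) / 2)) as (x & hx & hfx);
    [lra | lra | lra | ].
  exists x. split; [ | exact hfx]. unfold unit_disk.
  pose proof (Cmod_triangle z (x - z)) as h.
  replace (z + (x - z))%C with x in h by ring. lra.
Qed.

Lemma near_identity_starlike {f f' : C -> C} {sigma K : R}
  (hf : near_identity f f' sigma K) : f' 0 = 1 -> starlike_in_disk f.
Proof.
  intros hf'0.
  split; [ | split; [ | split; [ | split]]].
  - intros z hz. exists (f' z). apply (near_identity_is_derive hf), hz.
  - apply hf.
  - rewrite <- hf'0. apply (near_identity_is_derive hf). rewrite Cmod_0. lra.
  - intros z w hz hw. apply (near_identity_injective hf); apply Rlt_le; assumption.
  - split; [apply (near_identity_image_open hf) | split].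
    + exists 0. split; [unfold unit_disk; rewrite Cmod_0; lra | apply hf].
    + intros w t (z & hz & <-) ht. apply (near_identity_segment hf); assumption.
Qed.

(** * Power series with small weighted coefficients *)

Lemma is_Cseries_minus (u v : nat -> C) (l m : C) : is_Cseries u l -> is_Cseries v m ->
  is_Cseries (fun k => u k - v k)%C (l - m)%C.
Proof. apply (is_series_minus (K := C_AbsRing) (V := C_NormedModule)). Qed.

Lemma is_Cseries_scal (c : C) (u : nat -> C) (l : C) : is_Cseries u l ->
  is_Cseries (fun k => c * u k)%C (c * l)%C.
Proof. apply (is_series_scal (K := C_AbsRing) (V := C_NormedModule) c). Qed.

Lemma is_series_Rscal_r (c : R) (u : nat -> R) (l : R) : is_series u l ->
  is_series (fun k => u k * c) (l * c).
Proof. apply (is_series_scal_r c). Qed.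

Lemma ex_series_Rle (u v : nat -> R) : (forall k, 0 <= u k <= v k) ->
  ex_series v -> ex_series u.
Proof.
  intros h. apply (ex_series_le (V := R_CompleteNormedModule)).
  intros k. change (norm (u k)) with (Rabs (u k)). rewrite Rabs_pos_eq; apply h.
Qed.

(** Here [d k] is the coefficient of [z^(k+2)]. The starlike clause holds because [|f - z f'|] is at
    most [|z|] times the sum of [(k + 1) |d k|], while [|f|] is at least [|z|] times one minus the
    sum of [|d k|], and these two sums add up to [sigma < 1]. *)
Lemma power_series_near_identity (d : nat -> C) (f f' : C -> C) :
  ex_series (fun k => (INR k + 2) * (INR k + 1) * Cmod (d k)) ->
  Series (fun k => (INR k + 2) * Cmod (d k)) < 1 ->
  (forall z, Cmod z <= 1 -> is_Cseries (fun k => d k * z ^ S (S k))%C (f z - z)%C) ->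
  (forall z, Cmod z <= 1 ->
     is_Cseries (fun k => RtoC (INR k + 2) * d k * z ^ S k)%C (f' z - 1)%C) ->
  near_identity f f' (Series (fun k => (INR k + 2) * Cmod (d k)))
    (Series (fun k => (INR k + 2) * (INR k + 1) * Cmod (d k))) /\ f' 0 = 1.
Proof.
  intros hex hs hf hf'.
  assert (hnn : forall k, 0 <= INR k /\ 0 <= Cmod (d k))
    by (intros k; split; [apply pos_INR | apply Cmod_ge_0]).
  assert (ex1 : ex_series (fun k => (INR k + 2) * Cmod (d k))).
  { apply ex_series_Rle with (2 := hex). intros k. destruct (hnn k).
    assert (0 <= INR k * Cmod (d k)) by (apply Rmult_le_pos; assumption).
    assert (0 <= INR k * INR k * Cmod (d k)) by (repeat apply Rmult_le_pos; assumption).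
    split; nra. }
  assert (ex2 : ex_series (fun k => (INR k + 1) * Cmod (d k))).
  { apply ex_series_Rle with (2 := ex1). intros k. destruct (hnn k).
    assert (0 <= INR k * Cmod (d k)) by (apply Rmult_le_pos; assumption).
    split; nra. }
  assert (ex3 : ex_series (fun k => Cmod (d k))).
  { apply ex_series_Rle with (2 := ex1). intros k. destruct (hnn k).
    assert (0 <= INR k * Cmod (d k)) by (apply Rmult_le_pos; assumption).
    split; nra. }
  set (sigma := Series (fun k => (INR k + 2) * Cmod (d k))) in *.
  set (K := Series (fun k => (INR k + 2) * (INR k + 1) * Cmod (d k))).
  assert (hsplit : sigma
    = Series (fun k => (INR k + 1) * Cmod (d k)) + Series (fun k => Cmod (d k))).
  { unfold sigma. rewrite <- Series_plus by assumption.
    apply Series_ext. intros k. ring. }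
  apply Series_correct in hex, ex1, ex2, ex3. fold sigma in ex1. fold K in hex.
  (* Read off from [|f' 0 - 1| <= sigma], obtained termwise at [z = 0]. *)
  assert (hs0 : 0 <= sigma).
  { apply Rle_trans with (Cmod 0); [apply Cmod_ge_0 | ].
    apply (is_Cseries_Cmod_le _ _ (f' 0 - 1)%C _ (hf' 0 ltac:(rewrite Cmod_0; lra)))
      in ex1 as h; [ | ].
    - rewrite Cmod_0. eapply Rle_trans; [apply Cmod_ge_0 | exact h].
    - intros k. rewrite !Cmod_mult, Cmod_R, Rabs_pos_eq, Cmod_pow, Cmod_0, pow_i by
        (try lia; destruct (hnn k); lra).
      destruct (hnn k). rewrite Rmult_0_r. apply Rmult_le_pos; lra. }
  (* The factor [Cmod z] is kept so that evaluation at [0] yields [f 0 = 0]; [hfz'] likewise yields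
     [f' 0 = 1]. *)
  assert (hfz : forall z, Cmod z <= 1 ->
    Cmod (f z - z) <= Series (fun k => Cmod (d k)) * Cmod z).
  { intros z hz.
    apply (is_Cseries_Cmod_le _ _ _ _ (hf z hz) (is_series_Rscal_r (Cmod z) _ _ ex3)).
    intros k. rewrite Cpow_S, !Cmod_mult.
    pose proof (Cmod_pow_le_1 z (S k) hz). pose proof (Cmod_ge_0 z).
    apply Rmult_le_compat_l; [apply Cmod_ge_0 | nra]. }
  assert (hfz' : forall z, Cmod z <= 1 -> Cmod (f' z - 1) <= sigma * Cmod z).
  { intros z hz.
    apply (is_Cseries_Cmod_le _ _ _ _ (hf' z hz) (is_series_Rscal_r (Cmod z) _ _ ex1)).
    intros k. destruct (hnn k).
    rewrite Cpow_S, !Cmod_mult, Cmod_R, Rabs_pos_eq by lra.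
    pose proof (Cmod_pow_le_1 z k hz). pose proof (Cmod_ge_0 z).
    apply Rmult_le_compat_l; [apply Rmult_le_pos; lra | nra]. }
  assert (h01 : Cmod 0 <= 1) by (rewrite Cmod_0; lra).
  split; [split; [ | split; [ | split; [ | split; [ | split; [ | split]]]]] | ].
  - split; assumption.
  - apply Rle_trans with sigma; [exact hs0 | ].
    unfold sigma, K. apply Series_le; [ | eexists; exact hex].
    intros k. destruct (hnn k).
    assert (0 <= INR k * Cmod (d k)) by (apply Rmult_le_pos; assumption).
    assert (0 <= INR k * INR k * Cmod (d k)) by (repeat apply Rmult_le_pos; assumption).
    split; nra.
  - apply Cmod_eq_minus. pose proof (hfz 0 h01). rewrite Cmod_0 in *. lra.
  - intros z w hz hw.
    replace (f z - f w - (z - w))%C with ((f z - z) - (f w - w))%C by ring.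
    apply (is_Cseries_Cmod_le _ _ _ _ (is_Cseries_minus _ _ _ _ (hf z hz) (hf w hw))
      (is_series_Rscal_r (Cmod (z - w)) _ _ ex1)).
    intros k. replace (d k * z ^ S (S k) - d k * w ^ S (S k))%C
      with (d k * (z ^ S (S k) - w ^ S (S k)))%C by ring.
    rewrite Cmod_mult.
    pose proof (Cpow_lipschitz z w (S (S k)) hz hw) as h. rewrite !S_INR in h.
    destruct (hnn k). nra.
  - intros z w hz hw.
    replace (f z - f w - f' w * (z - w))%C
      with ((f z - z) - (f w - w) - (z - w) * (f' w - 1))%C by ring.
    apply (is_Cseries_Cmod_le _ _ _ _
      (is_Cseries_minus _ _ _ _ (is_Cseries_minus _ _ _ _ (hf z hz) (hf w hw))
        (is_Cseries_scal (z - w)%C _ _ (hf' w hw)))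
      (is_series_Rscal_r (Cmod (z - w) ^ 2) _ _ hex)).
    intros k.
    pose proof (Cpow_taylor z w (S k) hz hw) as h. rewrite S_INR in h.
    replace (INR k + 1 + 1) with (INR k + 2) in h by ring.
    replace (d k * z ^ S (S k) - d k * w ^ S (S k)
             - (z - w) * (RtoC (INR k + 2) * d k * w ^ S k))%C
      with (d k * (z ^ S (S k) - w ^ S (S k)
             - RtoC (INR k + 2) * w ^ S k * (z - w)))%C by ring.
    rewrite Cmod_mult. destruct (hnn k). nra.
  - intros z hz.
    pose proof (Cmod_ge_minus 1 (f' z - 1)) as h. rewrite Cmod_1 in h.
    replace (1 + (f' z - 1))%C with (f' z) in h by ring.
    pose proof (hfz' z hz). pose proof (Cmod_ge_0 z). nra.
  - intros z hz.
    assert (h1 : Cmod (f z - z * f' z)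
      <= Series (fun k => (INR k + 1) * Cmod (d k)) * Cmod z).
    { replace (f z - z * f' z)%C with ((f z - z) - z * (f' z - 1))%C by ring.
      apply (is_Cseries_Cmod_le _ _ _ _
        (is_Cseries_minus _ _ _ _ (hf z hz) (is_Cseries_scal z _ _ (hf' z hz)))
        (is_series_Rscal_r (Cmod z) _ _ ex2)).
      intros k. destruct (hnn k).
      replace (d k * z ^ S (S k) - z * (RtoC (INR k + 2) * d k * z ^ S k))%C
        with (- (RtoC (INR k + 1) * d k * (z * z ^ S k)))%C
        by (rewrite (Cpow_S z (S k)); replace (INR k + 2) with (INR k + 1 + 1) by ring;
            rewrite (RtoC_plus (INR k + 1) 1); ring).
      rewrite Cmod_opp, !Cmod_mult, Cmod_R, Rabs_pos_eq by lra.
      pose proof (Cmod_pow_le_1 z (S k) hz). pose proof (Cmod_ge_0 z).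
      apply Rmult_le_compat_l; [apply Rmult_le_pos; lra | nra]. }
    pose proof (hfz z hz) as h2.
    pose proof (Cmod_ge_minus z (f z - z)) as h3.
    replace (z + (f z - z))%C with (f z) in h3 by ring.
    pose proof (Cmod_ge_0 z). nra.
  - apply Cmod_eq_minus. pose proof (hfz' 0 h01). rewrite Cmod_0 in *. lra.
Qed.

Lemma power_series_starlike (c : nat -> C) : c 0%nat = 1 ->
  ex_series (fun k => (INR k + 2) * (INR k + 1) * Cmod (c (S k))) ->
  Series (fun k => (INR k + 2) * Cmod (c (S k))) < 1 ->
  starlike_in_disk (fun z => iota (T := C_CompleteNormedModule)
    (is_Cseries (fun k => c k * z ^ (k + 1))%C)).
Proof.
  intros hc0 hex hs.
  assert (hf : forall z, Cmod z <= 1 ->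
    is_Cseries (fun k => c (S k) * z ^ S (S k))%C
      (iota (T := C_CompleteNormedModule)
        (is_Cseries (fun k => c k * z ^ (k + 1))%C) - z)%C).
  { intros z hz.
    destruct (ex_Cseries_Cmod (fun k => c (S k) * z ^ S (S k))%C) as [l hl].
    { apply ex_series_Rle with (2 := hex). intros k.
      split; [apply Cmod_ge_0 | ]. rewrite Cmod_mult.
      pose proof (Cmod_pow_le_1 z (S (S k)) hz). pose proof (Cmod_ge_0 (c (S k))).
      pose proof (pos_INR k).
      assert (1 <= (INR k + 2) * (INR k + 1)) by nra. nra. }
    rewrite (iota_Cseries _ (l + z)%C).
    - replace (l + z - z)%C with l by ring. exact hl.
    (* Removes the term of index [0], which is [z] because [c 0 = 1]. *)
    - apply (is_series_decr_1 (K := C_AbsRing) (V := C_NormedModule)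
        (fun k => c k * z ^ (k + 1))%C).
      change (is_Cseries (fun k => c (S k) * z ^ (S k + 1))%C
        (l + z - c 0%nat * z ^ (0 + 1))%C).
      rewrite hc0. replace (l + z - 1 * z ^ (0 + 1))%C with l by (simpl; ring).
      apply (is_series_ext (K := C_AbsRing) (V := C_NormedModule)
        (fun k => c (S k) * z ^ S (S k))%C); [ | exact hl].
      intros k. replace (S k + 1)%nat with (S (S k)) by lia. reflexivity. }
  (* The derivative is taken to be [1] plus the sum of the termwise derivatives; the form
     [1 + ... - 1] matches [f' z - 1]. *)
  assert (hf' : forall z, Cmod z <= 1 ->
    is_Cseries (fun k => RtoC (INR k + 2) * c (S k) * z ^ S k)%C
      (1 + iota (T := C_CompleteNormedModule)
        (is_Cseries (fun k => RtoC (INR k + 2) * c (S k) * z ^ S k)) - 1)%C).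
  { intros z hz.
    destruct (ex_Cseries_Cmod (fun k => RtoC (INR k + 2) * c (S k) * z ^ S k)%C)
      as [l hl].
    { apply ex_series_Rle with (2 := hex). intros k. pose proof (pos_INR k).
      split; [apply Cmod_ge_0 | ].
      rewrite !Cmod_mult, Cmod_R, Rabs_pos_eq by lra.
      pose proof (Cmod_pow_le_1 z (S k) hz). pose proof (Cmod_ge_0 (c (S k))).
      assert (0 <= (INR k + 2) * Cmod (c (S k))) by (apply Rmult_le_pos; lra).
      nra. }
    rewrite (iota_Cseries _ l hl). replace (1 + l - 1)%C with l by ring. exact hl. }
  destruct (power_series_near_identity (fun k => c (S k))
    (fun z => iota (T := C_CompleteNormedModule) (is_Cseries (fun k => c k * z ^ (k + 1))%C))
    (fun z => 1 + iota (T := C_CompleteNormedModule)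
      (is_Cseries (fun k => RtoC (INR k + 2) * c (S k) * z ^ S k)))%C
    hex hs hf hf') as [hnear h0].
  exact (near_identity_starlike hnear h0).
Qed.

Theorem theorem3p5 (a b mu nu : R)
  (ha : 0 < a) (hb : 0 < b) (hmu : 0 < mu) (hnu : 0 < nu)
  (h_i : Gamma (a + 2 * mu) / Gamma (a + 3 * mu)
         < 3 * Gamma (b + 3 * nu) / (8 * Gamma (b + 2 * nu)))
  (h_ii : Gamma (a + mu) * Gamma (a + 3 * mu) / Gamma (a + 2 * mu) ^ 2
          < 16 * Gamma (b + 2 * nu) ^ 2
            / (9 * Gamma (b + nu) * Gamma (b + 3 * nu)))
  (h_iii : 2 * Gamma a * Gamma b / (Gamma (a + mu) * Gamma (b + nu))
           - 3 * (1 - exp 1) * Gamma a * Gamma b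
             / (Gamma (a + 2 * mu) * Gamma (b + 2 * nu))
           < 2 / sqrt 5) :
  starlike_in_disk (Wright mu a nu b).
Proof.
  destruct (wright_weights a b mu nu ha hb hmu hnu h_iii) as [hex hs].
  assert (hmod : forall k, Cmod (RtoC (wright_coeff mu a nu b (S k)))
    = wright_coeff mu a nu b (S k)).
  { intros k. rewrite Cmod_R. apply Rabs_pos_eq, Rlt_le.
    apply wright_coeff_pos; assumption. }
  (* [Wright] unfolds to this power series, and its positive coefficients equal their moduli. *)
  apply (power_series_starlike (fun k => RtoC (wright_coeff mu a nu b k))).
  - rewrite wright_coeff_0 by assumption. reflexivity.
  - apply ex_series_ext with (2 := hex). intros k. rewrite hmod. reflexivity.
  - rewrite (Series_ext _ (fun k => (INR k + 2) * wright_coeff mu a nu b (S k)));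
      [exact hs | ].
    intros k. rewrite hmod. reflexivity.
Qed.
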